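(* Let $\mathcal{Q}(\mathcal{V}):=\mathcal{S}_{\mathrm{reg}}^{-1}\mathcal{V}=\mathcal{U}(\mathcal{V})^{-1}\mathcal{V}$ be the localization of the ring $\mathcal{V}$ at its multiplicative set of nodeless sequences. Then: (1) Every element of $\mathcal{Q}(\mathcal{V})$ can be written as a quotient of some $\Psi\in\mathcal{V}$ by some $\Phi\in\mathcal{U}(\mathcal{V})$. (2) The localization map $\mathcal{V}\to\mathcal{Q}(\mathcal{V})$ is a ring isomorphism, so $\mathcal{Q}(\mathcal{V})\cong\mathcal{V}$. (3) For every fixed $n\in\mathbb{N}$, $n\geq 1$, the subring $\mathcal{V}_n\subset\mathcal{V}$ of $n$-periodic sequences is isomorphic as a ring to a direct sum of $n$ copies of the complex field, $$\mathcal{V}_n\cong\bigoplus_{k=1}^n\mathbb{C},$$ in which the field of scalars $\{c\,\mathbf{w}(0,0)\mid c\in\mathbb{C}\}\cong\mathbb{C}$ embeds diagonally.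
   Context: For $f\in\mathbb{Q}/\mathbb{Z}$ and $g\in\mathbb{Q}$, $\mathbf{w}(f,g):\mathbb{Z}\to\mathbb{C}$ is the sequence $\mathbf{w}(f,g)[m]=\exp(2\pi i(fm+g))$. $\mathcal{V}=\operatorname{span}_{\mathbb{C}}\{\mathbf{w}(f,g)\mid f\in\mathbb{Q}/\mathbb{Z},\,g\in\mathbb{Q}\}$ is a commutative ring under pointwise addition and pointwise multiplication $\otimes$, with unit $\mathbf{1}=\mathbf{w}(0,0)$; all its elements are periodic sequences. $\mathcal{U}(\mathcal{V})$ is the set of nodeless elements, i.e. those $\Phi\in\mathcal{V}$ with $\Phi[m]\ne0$ for all $m\in\mathbb{Z}$. $\mathcal{S}_{\mathrm{reg}}=\{\Phi\in\mathcal{V}\mid\Phi\otimes\Psi=\mathbf{0}\Rightarrow\Psi=\mathbf{0}\}$ is the set of non-zero-divisors of $\mathcal{V}$, which coincides with $\mathcal{U}(\mathcal{V})$. *)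

(* Defs.v *)
From HB Require Import structures.
From mathcomp Require Import all_boot all_order all_algebra.
From mathcomp Require Import generic_quotient ring_quotient complex.
From mathcomp Require Import all_classical all_reals all_analysis.
From mathcomp Require Import ring.

Set Implicit Arguments.
Unset Strict Implicit.
Unset Printing Implicit Defensive.

Import Order.TTheory GRing.Theory Num.Theory.

Local Open Scope ring_scope.
Local Open Scope quotient_scope.
Local Open Scope classical_set_scope.
Local Open Scope complex_scope.

Section Localization.
Variables (A : comPzRingType) (S : mulrClosed A).
Implicit Types x y z : (A * {s : A | s \in S})%type.

(* (a, s) ~ (b, t) iff u (a t - b s) = 0 for some u in S. *)
Definition loc_equiv x y : bool :=
  `[< exists2 u, u \in S & u * (x.1 * sval y.2 - y.1 * sval x.2) = 0 >].

Lemma loc_equivP x y : reflect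
  (exists2 u, u \in S & u * (x.1 * sval y.2) = u * (y.1 * sval x.2))
  (loc_equiv x y).
Proof.
rewrite /loc_equiv; apply: (iffP (asboolP _)) => -[u uS e]; exists u => //.
  by apply/eqP; rewrite -subr_eq0 -mulrBr e.
by rewrite mulrBr e subrr.
Qed.

Lemma loc_equiv_class : equiv_class_of loc_equiv.
Proof.
split=> [x|x y|y x z].
- by apply/loc_equivP; exists 1; rewrite ?rpred1.
- by apply/loc_equivP/loc_equivP => -[u uS e]; exists u.
case/loc_equivP=> u uS e /loc_equivP[v vS f]; apply/loc_equivP.
exists (u * v * sval y.2); first by rewrite !rpredM ?(svalP y.2).
transitivity (v * sval z.2 * (u * (x.1 * sval y.2))); first by ring.
rewrite e; transitivity (u * sval x.2 * (v * (y.1 * sval z.2))); first by ring.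
by rewrite f; ring.
Qed.

Canonical loc_equiv_equiv := EquivRelPack loc_equiv_class.
Canonical loc_equiv_encModRel := defaultEncModRel loc_equiv.

Definition localization := {eq_quot loc_equiv}.
Local Notation Q := localization.
HB.instance Definition _ : EqQuotient _ loc_equiv Q := EqQuotient.on Q.
HB.instance Definition _ := Choice.on Q.

Definition loc_frac (a s : A) (sS : s \in S) : Q := \pi_Q (a, exist _ s sS).

Lemma loc_frac_eqP a b s t (sS : s \in S) (tS : t \in S) :
  loc_frac a sS = loc_frac b tS <->
      exists2 u, u \in S & u * (a * t) = u * (b * s).
Proof.
rewrite /loc_frac; split=> [/eqP|e]; first by rewrite eqmodE => /loc_equivP.
by apply/eqP; rewrite eqmodE; apply/loc_equivP.
Qed.

Lemma loc_fracW (P : Q -> Prop) :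
  (forall a s (sS : s \in S), P (loc_frac a sS)) -> forall q, P q.
Proof.
by move=> PS q; rewrite -[q]reprK; case: (repr q) => a [s sS]; exact: PS.
Qed.

Lemma loc_fracI a b s t (sS : s \in S) (tS : t \in S) :
  a * t = b * s -> loc_frac a sS = loc_frac b tS.
Proof. by move=> e; apply/loc_frac_eqP; exists 1; rewrite ?rpred1 ?e. Qed.

Lemma repr_loc_frac a s (sS : s \in S) :
  exists b t (tS : t \in S) u, [/\ repr (loc_frac a sS) = (b, exist _ t tS),
    u \in S & u * (b * s) = u * (a * t)].
Proof.
have := reprK (loc_frac a sS); case: (repr _) => b [t tS].
by move/(loc_frac_eqP _ _ tS sS) => [u uS e]; exists b, t, tS, u.
Qed.

Definition loc_zero : Q := loc_frac 0 (rpred1 S).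
Definition loc_one : Q := loc_frac 1 (rpred1 S).
Definition loc_opp (p : Q) : Q :=
  let x := repr p in loc_frac (- x.1) (svalP x.2).
Definition loc_add (p q : Q) : Q := let x := repr p in let y := repr q in
  loc_frac (x.1 * sval y.2 + y.1 * sval x.2) (rpredM (svalP x.2) (svalP y.2)).
Definition loc_mul (p q : Q) : Q := let x := repr p in let y := repr q in
  loc_frac (x.1 * y.1) (rpredM (svalP x.2) (svalP y.2)).

Lemma loc_oppE a s (sS : s \in S) : loc_opp (loc_frac a sS) = loc_frac (- a) sS.
Proof.
have [b [t [tS [u [rE uS e]]]]] := repr_loc_frac a sS.
rewrite /loc_opp rE /=; apply/loc_frac_eqP; exists u => //.
by rewrite !mulNr !mulrN e.
Qed.

Lemma loc_addE a b s t (sS : s \in S) (tS : t \in S) :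
  loc_add (loc_frac a sS) (loc_frac b tS) =
      loc_frac (a * t + b * s) (rpredM sS tS).
Proof.
have [a' [s' [sS' [u [rE uS e]]]]] := repr_loc_frac a sS.
have [b' [t' [tS' [v [rE' vS f]]]]] := repr_loc_frac b tS.
rewrite /loc_add rE rE' /=; apply/loc_frac_eqP; exists (u * v).
  by rewrite rpredM.
transitivity (v * t * t' * (u * (a' * s)) + u * s * s' * (v * (b' * t))).
  by ring.
by rewrite e f; ring.
Qed.

Lemma loc_mulE a b s t (sS : s \in S) (tS : t \in S) :
  loc_mul (loc_frac a sS) (loc_frac b tS) = loc_frac (a * b) (rpredM sS tS).
Proof.
have [a' [s' [sS' [u [rE uS e]]]]] := repr_loc_frac a sS.
have [b' [t' [tS' [v [rE' vS f]]]]] := repr_loc_frac b tS.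
rewrite /loc_mul rE rE' /=; apply/loc_frac_eqP; exists (u * v).
  by rewrite rpredM.
transitivity ((u * (a' * s)) * (v * (b' * t))); first by ring.
by rewrite e f; ring.
Qed.

Lemma loc_addA : associative loc_add.
Proof.
elim/loc_fracW=> a s sS; elim/loc_fracW=> b t tS; elim/loc_fracW=> c r rS.
by rewrite !loc_addE; apply: loc_fracI; ring.
Qed.

Lemma loc_addC : commutative loc_add.
Proof.
elim/loc_fracW=> a s sS; elim/loc_fracW=> b t tS.
by rewrite !loc_addE; apply: loc_fracI; ring.
Qed.

Lemma loc_add0 : left_id loc_zero loc_add.
Proof.
by elim/loc_fracW=> a s sS; rewrite loc_addE; apply: loc_fracI; ring.
Qed.

Lemma loc_addN : left_inverse loc_zero loc_opp loc_add.
Proof.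
by elim/loc_fracW=> a s sS; rewrite loc_oppE loc_addE; apply: loc_fracI; ring.
Qed.

HB.instance Definition _ :=
  GRing.isZmodule.Build Q loc_addA loc_addC loc_add0 loc_addN.

Lemma loc_mulA : associative loc_mul.
Proof.
elim/loc_fracW=> a s sS; elim/loc_fracW=> b t tS; elim/loc_fracW=> c r rS.
by rewrite !loc_mulE; apply: loc_fracI; ring.
Qed.

Lemma loc_mulC : commutative loc_mul.
Proof.
elim/loc_fracW=> a s sS; elim/loc_fracW=> b t tS.
by rewrite !loc_mulE; apply: loc_fracI; ring.
Qed.

Lemma loc_mul1 : left_id loc_one loc_mul.
Proof.
by elim/loc_fracW=> a s sS; rewrite loc_mulE; apply: loc_fracI; ring.
Qed.

Lemma loc_mulDl : left_distributive loc_mul loc_add.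
Proof.
elim/loc_fracW=> a s sS; elim/loc_fracW=> b t tS; elim/loc_fracW=> c r rS.
by rewrite loc_addE !loc_mulE loc_addE; apply: loc_fracI; ring.
Qed.

HB.instance Definition _ :=
  GRing.Zmodule_isComPzRing.Build Q loc_mulA loc_mulC loc_mul1 loc_mulDl.

Lemma loc_fracN a s (sS : s \in S) : - loc_frac a sS = loc_frac (- a) sS.
Proof. exact: loc_oppE. Qed.

Lemma loc_fracD a b s t (sS : s \in S) (tS : t \in S) :
  loc_frac a sS + loc_frac b tS = loc_frac (a * t + b * s) (rpredM sS tS).
Proof. exact: loc_addE. Qed.

Lemma loc_fracM a b s t (sS : s \in S) (tS : t \in S) :
  loc_frac a sS * loc_frac b tS = loc_frac (a * b) (rpredM sS tS).
Proof. exact: loc_mulE. Qed.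

Definition loc_map (a : A) : Q := loc_frac a (rpred1 S).

Lemma loc_map_zmod_morphism : zmod_morphism loc_map.
Proof.
by move=> a b; rewrite /loc_map loc_fracN loc_fracD; apply: loc_fracI; ring.
Qed.

Lemma loc_map_monoid_morphism : monoid_morphism loc_map.
Proof.
by split=> // a b; rewrite /loc_map loc_fracM; apply: loc_fracI; ring.
Qed.

HB.instance Definition _ :=
  GRing.isZmodMorphism.Build A Q loc_map loc_map_zmod_morphism.
HB.instance Definition _ :=
  GRing.isMonoidMorphism.Build A Q loc_map loc_map_monoid_morphism.

Lemma loc_map_inv s (sS : s \in S) : loc_map s * loc_frac 1 sS = 1.
Proof. by rewrite /loc_map loc_fracM; apply: loc_fracI; ring. Qed.

Lemma loc_fracE a s (sS : s \in S) : loc_frac a sS = loc_map a * loc_frac 1 sS.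
Proof. by rewrite /loc_map loc_fracM; apply: loc_fracI; ring. Qed.

End Localization.

Section NonZeroDivisors.
Variable A : comPzRingType.

Definition nonzerodiv : {pred A} :=
  fun a => `[< forall b, a * b = 0 -> b = 0 >].

Lemma nonzerodiv_mulr_closed : mulr_closed nonzerodiv.
Proof.
split=> [|a b /asboolP aP /asboolP bP]; apply/asboolP => c.
  by rewrite mul1r.
by rewrite -mulrA => /aP/bP.
Qed.

HB.instance Definition _ :=
  GRing.isMulClosed.Build A nonzerodiv nonzerodiv_mulr_closed.

End NonZeroDivisors.

Definition lin_span (K : pzRingType) (M : lmodType K) (X : set M) : set M :=
  [set x | exists n (c : 'I_n -> K) (v : 'I_n -> M),
     (forall i, X (v i)) /\ x = \sum_i c i *: v i].

Section LinSpan.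
Variables (K : pzRingType) (M : lmodType K) (X : set M).
Local Notation span := (lin_span X).

Lemma lin_span_gen x : X x -> span x.
Proof.
move=> Xx; exists 1%N, (fun=> 1), (fun=> x); split=> //.
by rewrite big_ord1 scale1r.
Qed.

Lemma lin_span0 : span 0.
Proof.
by exists 0%N, (fun=> 0), (fun=> 0); split=> [[]|]; rewrite // big_ord0.
Qed.

Lemma lin_spanZ k x : span x -> span (k *: x).
Proof.
case=> n [c [v [Xv ->]]]; exists n, (fun i => k * c i), v; split=> //.
by rewrite scaler_sumr; apply: eq_bigr => i _; rewrite scalerA.
Qed.

Lemma lin_spanD x y : span x -> span y -> span (x + y).
Proof.
case=> n [c [v [Xv ->]]] [p [d [u [Xu ->]]]].
exists (n + p)%N, (fun i => match fintype.split i with inl j => c j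
      | inr j => d j end),
  (fun i => match fintype.split i with inl j => v j | inr j => u j end).
split=> [i|]; first by case: fintype.split.
rewrite big_split_ord /=; congr (_ + _); apply: eq_bigr => i _.
  by rewrite (unsplitK (inl i)).
by rewrite (unsplitK (inr i)).
Qed.

Lemma lin_span_sum n (F : 'I_n -> M) :
  (forall i, span (F i)) -> span (\sum_i F i).
Proof.
by move=> FX; elim/big_ind: _ => //; [exact: lin_span0 | exact: lin_spanD].
Qed.

End LinSpan.

Definition rat_int : zmodClosed rat :=
  GRing.ZmodClosed.clone rat (@Num.int_num_subdef rat) _.
Definition QmodZ : zmodType := Quotient.quot rat_int.

Section Sequences.
Variable R : realType.
Local Notation C := R[i].

Definition cexp (z : C) : C :=
  (expR (complex.Re z))%:C * (cos (complex.Im z) +i* sin (complex.Im z)).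

(* The value does not depend on the representative of f: see [w_pi]. *)
Definition w (f : QmodZ) (g : rat) : int -> C :=
  fun m => cexp (2%:R * pi%:C * 'i * (ratr (repr f) * m%:~R + ratr g)).

Lemma cexpD (x y : C) : cexp (x + y) = cexp x * cexp y.
Proof.
case: x y => [a b] [c d]; rewrite /cexp /= expRD cosD sinD.
by apply/eqP; rewrite eq_complex /=; apply/andP; split; apply/eqP; ring.
Qed.

Lemma cexp0 : cexp 0 = 1.
Proof. by rewrite /cexp /= expR0 cos0 sin0 mulr1. Qed.

Lemma cexp_2piZ (k : int) : cexp (2%:R * pi%:C * 'i * k%:~R) = 1.
Proof.
have n1 : cexp (2%:R * pi%:C * 'i) = 1.
  have -> : 2%:R * pi%:C * 'i = 0 +i* (pi *+ 2) :> C.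
    rewrite -(rmorph_nat (real_complex R)).
    apply/eqP; rewrite eq_complex /=; apply/andP; split; apply/eqP; ring.
  by rewrite /cexp /= expR0 cos2pi sin2pi mul1r.
have nat n : cexp (2%:R * pi%:C * 'i * n%:R) = 1.
  elim: n => [|n IH]; first by rewrite mulr0 cexp0.
  by rewrite -[n.+1]addn1 (natrD _ n 1) [X in cexp X]mulrDr
      mulr1 cexpD IH n1 mulr1.
case: k => n; first exact: nat.
have := cexpD (2%:R * pi%:C * 'i * (Negz n)%:~R) (2%:R * pi%:C * 'i * n.+1%:R).
by rewrite nat mulr1 NegzE mulrNz mulrN addNr cexp0.
Qed.

Lemma w_pi (q g : rat) (m : int) : w (\pi_QmodZ q) g m =
  cexp (2%:R * pi%:C * 'i * (ratr q * m%:~R + ratr g)).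
Proof.
rewrite /w; set p := repr _.
have /intrP[k kE] : q - p \is a Num.int.
  have : \pi_QmodZ q == \pi_QmodZ p by rewrite reprK.
  by rewrite eqmodE.
have -> : ratr q = ratr p + k%:~R :> C.
  by rewrite -(subrK p q) kE rmorphD /= ratr_int addrC.
have -> : (ratr p + k%:~R) * m%:~R + ratr g
    = (ratr p * m%:~R + ratr g) + (k * m)%:~R :> C by rewrite intrM; ring.
by rewrite [X in _ = cexp X]mulrDr cexpD cexp_2piZ mulr1.
Qed.

Lemma w00 : w 0 0 = 1.
Proof.
apply/funext => m; have <- : \pi_QmodZ 0 = 0 by rewrite raddf0.
by rewrite w_pi !rmorph0 mul0r addr0 mulr0 cexp0.
Qed.

Lemma wM f g f' g' : w f g * w f' g' = w (f + f') (g + g').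
Proof.
apply/funext => m; rewrite -[f + f'](_ : \pi_QmodZ (repr f + repr f') = _).
  by rewrite w_pi mulrfctE /w -cexpD -mulrDr !rmorphD /=;
    congr (cexp (_ * _)); ring.
by rewrite raddfD /= !reprK.
Qed.

Definition Vset : set (int -> C) :=
  lin_span [set s | exists f g, s = w f g].

Definition Vpred : {pred int -> C} := mem Vset.

Lemma VpredP s : reflect (Vset s) (s \in Vpred).
Proof. by apply: (iffP idP); rewrite in_setE. Qed.

Lemma Vpred_w f g : w f g \in Vpred.
Proof. by apply/VpredP/lin_span_gen; exists f, g. Qed.

Lemma VpredZ c s : s \in Vpred -> c *: s \in Vpred.
Proof. by move/VpredP => sV; apply/VpredP/lin_spanZ. Qed.

Lemma Vpred_subring_closed : subring_closed Vpred.
Proof.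
split=> [|s t /VpredP sV /VpredP tV|s t].
- by rewrite -w00 Vpred_w.
- by apply/VpredP; rewrite -scaleN1r; apply/lin_spanD/lin_spanZ.
move=> /VpredP[n [c [u [uW ->]]]] /VpredP[p [d [v [vW ->]]]]; apply/VpredP.
rewrite mulr_suml; apply: lin_span_sum => i; rewrite mulr_sumr.
apply: lin_span_sum => j.
have [[f [g ->]] [f' [g' ->]]] := (uW i, vW j).
have -> : c i *: w f g * (d j *: w f' g') = (c i * d j) *: w (f + f') (g + g').
  rewrite -wM; apply/funext => m; rewrite !fctE /GRing.scale /=; ring.
by apply/lin_spanZ/lin_span_gen; exists (f + f'), (g + g').
Qed.

HB.instance Definition _ :=
  GRing.isSubringClosed.Build (int -> C) Vpred Vpred_subring_closed.

Record V := MkV { seqV :> int -> C; seqVP : seqV \in Vpred }.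
HB.instance Definition _ := [isSub for seqV].
HB.instance Definition _ := [Choice of V by <:].
HB.instance Definition _ := GRing.SubChoice_isSubComPzRing.Build _ _ V
  Vpred_subring_closed.

Definition nodeless : {pred V} :=
  fun Phi => `[< forall m : int, Phi m != 0 >].

Lemma nodeless_mulr_closed : mulr_closed nodeless.
Proof.
split=> [|P Q /asboolP hP /asboolP hQ]; apply/asboolP => m.
  exact: oner_neq0.
exact: mulf_neq0.
Qed.

HB.instance Definition _ :=
  GRing.isMulClosed.Build V nodeless nodeless_mulr_closed.

Definition periodic (n : nat) : {pred V} :=
  fun Phi => `[< forall m : int, Phi (m + n%:Z) = Phi m >].

Section Periodic.
Variable n : nat.
Lemma periodic_subring_closed : subring_closed (periodic n).
Proof.
split=> [|P Q /asboolP hP /asboolP hQ|P Q /asboolP hP /asboolP hQ];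
  apply/asboolP => m //=.
- by rewrite [LHS]/(P _ - Q _) hP hQ.
- by rewrite [LHS]/(P _ * Q _) hP hQ.
Qed.

HB.instance Definition _ :=
  GRing.isSubringClosed.Build V (periodic n) periodic_subring_closed.

Record Vn := MkVn { Vn_val :> V; VnP : Vn_val \in periodic n }.
HB.instance Definition _ := [isSub for Vn_val].
HB.instance Definition _ := [Choice of Vn by <:].
HB.instance Definition _ := GRing.SubChoice_isSubComPzRing.Build _ _ Vn
  periodic_subring_closed.

(* The scalar sequence c w(0,0), first in V, then in the subring Vn. *)
Definition scalV (c : C) : V := MkV (VpredZ c (Vpred_w 0 0)).

Lemma scalVE c m : scalV c m = c.
Proof. by rewrite /= w00; exact: mulr1. Qed.

Lemma scalV_periodic c : scalV c \in periodic n.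
Proof. by apply/asboolP => m; rewrite !scalVE. Qed.

Definition scal (c : C) : Vn := MkVn (scalV_periodic c).

Lemma scal_zmod_morphism : zmod_morphism scal.
Proof.
by move=> a b; do 2!apply: val_inj; rewrite /= scalerBl.
Qed.

Lemma scal_monoid_morphism : monoid_morphism scal.
Proof.
split=> [|a b]; do 2!apply: val_inj; apply/funext => m.
  by rewrite [LHS](scalVE 1).
rewrite [LHS](scalVE (a * b)); transitivity (scalV a m * scalV b m) => //.
by rewrite !scalVE.
Qed.

HB.instance Definition _ :=
  GRing.isZmodMorphism.Build C Vn scal scal_zmod_morphism.
HB.instance Definition _ :=
  GRing.isMonoidMorphism.Build C Vn scal scal_monoid_morphism.

End Periodic.
End Sequences.

Arguments nodeless R : clear implicits.
Arguments Vpred R : clear implicits.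
Arguments periodic R n : clear implicits.
Arguments scal R n : clear implicits.

Definition QV (R : realType) : comPzRingType := localization (nodeless R).

Definition ring_isomorphic (A B : pzRingType) : Prop :=
  exists e : {rmorphism A -> B}, bijective e.

(* Main.v *)
Require Import Defs.
From HB Require Import structures.
From mathcomp Require Import all_boot all_order all_algebra.
From mathcomp Require Import generic_quotient ring_quotient complex.
From mathcomp Require Import all_classical all_reals all_analysis.
From mathcomp Require Import ring.

Set Implicit Arguments.
Unset Strict Implicit.
Unset Printing Implicit Defensive.

Import Order.TTheory GRing.Theory Num.Theory.

Local Open Scope ring_scope.
Local Open Scope quotient_scope.
Local Open Scope complex_scope.

(** Everything follows from one identification: V is exactly the set of all
sequences Z -> C that are periodic with some positive period.

One inclusion ([V_period]): w(f,g) is periodic with period the denominator of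
f, and a finite linear combination is periodic with the product of the periods
of its terms. The other ([period_Vpred]) is the discrete Fourier transform: by
orthogonality of the characters j |-> exp(2 pi i j m / N) of Z/N
([sum_rat_exp]), the indicator of each residue class modulo N is a combination
of the w(j/N, - j a / N), and an N-periodic sequence is a combination of those
N indicators.

Periodicity is preserved by taking pointwise inverses, so nodeless elements are
units of V ([nodeless_invertible]). If on the contrary Phi, of period N,
vanishes at m, then the indicator of m + N Z is a nonzero element of V killed
by Phi. Hence the non-zero-divisors are the nodeless elements
([nonzerodiv_nodeless]); and localizing at a set of units changes nothing
([loc_map_bijective]), which settles the claims on Q(V).

Finally, an n-periodic sequence is freely determined by its values at
0, ..., n - 1, because every choice of these values extends periodically to an
element of V. So evaluation at these points is a ring isomorphism from V_n to
C^n ([Vn_eval_bijective]), and it sends constant sequences to constant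
vectors. *)

(** * The character q |-> exp(2 pi i q) of the rationals *)

Section RationalExponential.
Variable R : realType.
Local Notation C := R[i].
Implicit Types (p q g : rat) (m k : int).

(** This puts both arguments of w(f,g) into one rational exponent (see
[w_rat_exp]), so that periodicity and orthogonality become statements about a
character of Q with kernel Z. *)
Definition rat_exp q : C := cexp (2%:R * pi%:C * 'i * ratr q).

Lemma rat_expD p q : rat_exp (p + q) = rat_exp p * rat_exp q.
Proof. by rewrite /rat_exp [ratr _]rmorphD [X in cexp X]mulrDr cexpD. Qed.

Lemma rat_exp_int k : rat_exp k%:~R = 1.
Proof. by rewrite /rat_exp ratr_int cexp_2piZ. Qed.

Lemma rat_expMn q j : rat_exp (q *+ j) = rat_exp q ^+ j.
Proof.
elim: j => [|j IH]; first by rewrite mulr0n expr0 (rat_exp_int 0).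
by rewrite mulrS exprS rat_expD IH.
Qed.

Lemma w_rat_exp q g m :
  w R (\pi_QmodZ q) g m = rat_exp (q * m%:~R + g).
Proof.
rewrite w_pi /rat_exp; congr (cexp (_ * _)).
by rewrite rmorphD rmorphM /= ratr_int.
Qed.

Lemma Re_rat_exp q : complex.Re (rat_exp q) = cos (pi * ratr q *+ 2).
Proof.
rewrite /rat_exp.
have -> : 2%:R * pi%:C * 'i * ratr q = 0 +i* (pi * ratr q *+ 2) :> C.
  rewrite -(fmorph_rat (real_complex R)) -(rmorph_nat (real_complex R)).
  by apply/eqP; rewrite eq_complex /=; apply/andP; split; apply/eqP; ring.
by rewrite /cexp /= expR0; ring.
Qed.

(** The real part is cos(2x) with x = pi q. If it were 1, then sin(x) would be
0, which is impossible for x strictly between 0 and pi. *)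
Lemma rat_exp_neq1 q : 0 < q < 1 -> rat_exp q != 1.
Proof.
case/andP=> q0 q1; apply/eqP => /(congr1 (@complex.Re R)).
rewrite Re_rat_exp cos_mulr2n /= => c1.
have : 0 < sin (pi * ratr q : R).
  apply: sin_gt0_pi; rewrite mulr_gt0 ?pi_gt0 ?ltr0q //=.
  rewrite -subr_gt0 -{1}[pi]mulr1 -mulrBr mulr_gt0 ?pi_gt0// subr_gt0.
  by rewrite -(rmorph1 (@ratr R)) ltr_rat.
move=> s0; have /eqP : sin (pi * ratr q : R) ^+ 2 *+ 2 = 0.
  rewrite sin2cos2; transitivity (1 - (cos (pi * ratr q : R) ^+ 2 *+ 2 - 1)).
    by ring.
  by rewrite c1 subrr.
by rewrite mulrn_eq0 sqrf_eq0 (gt_eqF s0).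
Qed.

(** Geometric sum: the ratio z = exp(2 pi i m / N) is an N-th root of unity,
and it equals 1 exactly when N divides m, since it only depends on the
remainder of m modulo N. *)
Lemma sum_rat_exp N m : (0 < N)%N ->
  \sum_(j < N) rat_exp (j%:R / N%:R * m%:~R) = ((N%:Z %| m)%Z)%:R * N%:R.
Proof.
move=> N0; have N0' : N%:R != 0 :> rat by rewrite pnatr_eq0 -lt0n.
set z := rat_exp (m%:~R / N%:R).
have -> : \sum_(j < N) rat_exp (j%:R / N%:R * m%:~R) = \sum_(j < N) z ^+ j.
  apply: eq_bigr => j _; rewrite -rat_expMn; congr rat_exp.
  by rewrite -[RHS]mulr_natl; ring.
have zN : z ^+ N = 1.
  by rewrite -rat_expMn -[_ *+ N]mulr_natr divfK// rat_exp_int.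
have zr : z = rat_exp ((m %% N%:Z)%Z%:~R / N%:R).
  rewrite /z {1}(divz_eq m N%:Z) intrD mulrDl intrM mulfK//.
  by rewrite rat_expD rat_exp_int mul1r.
have [Nm|Nm] := boolP (N%:Z %| m)%Z; rewrite ?mul1r ?mul0r.
  have -> : z = 1 by rewrite zr (dvdz_mod0P Nm) mul0r (rat_exp_int 0).
  by under eq_bigr do rewrite expr1n; rewrite sumr_const card_ord.
have z1 : z - 1 != 0.
  rewrite subr_eq0 zr rat_exp_neq1//.
  have Nz : N%:Z != 0 by rewrite eqz_nat -lt0n.
  rewrite divr_gt0 ?ltr0n// ?ltr0z ?ltr_pdivrMr ?ltr0n// ?mul1r.
    by rewrite -[N%:R]/(N%:Z%:~R) ltr_int ltz_mod.
  by rewrite lt_def modz_ge0// andbT; apply: contra Nm => /eqP/dvdz_mod0P.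
by apply: (mulfI z1); rewrite -subrX1 zN subrr mulr0.
Qed.

End RationalExponential.

(** * Every element of V is periodic *)

Section Periodicity.
Variable R : realType.
Local Notation C := R[i].
Implicit Types (f : QmodZ) (g : rat) (m k : int) (s : int -> C).

Lemma scale_seqE (c : C) s m : (c *: s) m = c * s m.
Proof. by []. Qed.

Definition seq_period N s := forall m, s (m + N%:Z) = s m.

Lemma seq_periodZ N s : seq_period N s -> forall k m, s (m + k * N%:Z) = s m.
Proof.
move=> sN; have sNn j m : s (m + j%:Z * N%:Z) = s m.
  elim: j => [|j IH]; first by rewrite mul0r addr0.
  by rewrite -addn1 PoszD mulrDl mul1r addrA sN.
case=> j m; first exact: sNn.
by rewrite NegzE -(sNn j.+1) mulNr subrK.
Qed.

Lemma seq_period_modz N s m : seq_period N s -> s (m %% N%:Z)%Z = s m.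
Proof. by move=> sN; rewrite {2}(divz_eq m N%:Z) addrC seq_periodZ. Qed.

Lemma seq_period_dvd N M s : (N %| M)%N -> seq_period N s -> seq_period M s.
Proof.
by move=> /dvdnP[k ->] sN m; rewrite PoszM seq_periodZ.
Qed.

(** The denominator of f is a period: shifting by it changes the exponent by the
numerator of f, an integer. *)
Lemma w_period f g : exists2 N, (0 < N)%N & seq_period N (w R f g).
Proof.
exists `|denq (repr f)|%N; first by rewrite absz_gt0 denq_eq0.
move=> m; rewrite -[f]reprK !w_rat_exp absz_denq reprK intrD mulrDr addrAC.
by rewrite rat_expD -numqE rat_exp_int mulr1.
Qed.

(** The product of the periods of the terms is a common period. *)
Lemma lin_comb_period n (c : 'I_n -> C) (v : 'I_n -> int -> C) :
  (forall i, exists2 N, (0 < N)%N & seq_period N (v i)) ->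
  exists2 N, (0 < N)%N & seq_period N (\sum_i c i *: v i).
Proof.
move=> vP; have /fin_all_exists2[N N0 NP] := vP.
exists (\prod_i N i)%N; first by rewrite prodn_gt0.
have vN i : seq_period (\prod_i N i) (v i).
  by apply: seq_period_dvd (NP i); rewrite (bigD1 i) //= dvdn_mulr.
move=> m; rewrite !fct_sumE; apply: eq_bigr => i _.
by rewrite !scale_seqE vN.
Qed.

Lemma V_period (P : V R) : exists2 N, (0 < N)%N & seq_period N P.
Proof.
case: P => s /= /VpredP[n [c [v [vw ->]]]]; apply: lin_comb_period => i.
by have [f [g ->]] := vw i; exact: w_period.
Qed.

End Periodicity.

(** * Every periodic sequence lies in V *)

Section FourierInversion.
Variable R : realType.
Local Notation C := R[i].
Implicit Types (m a : int) (s : int -> C).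

Definition residue_indicator N a : int -> C :=
  fun m => ((N%:Z %| m - a)%Z)%:R.

(** Discrete Fourier expansion of the indicator: the phase - j a / N translates
the sum of characters by a. *)
Lemma residue_indicator_Vpred N a : (0 < N)%N ->
  residue_indicator N a \in Vpred R.
Proof.
move=> N0; have -> : residue_indicator N a = \sum_(j < N) N%:R^-1 *:
    w R (\pi_QmodZ (j%:R / N%:R)) (- (j%:R / N%:R * a%:~R)).
  apply/funext => m; rewrite fct_sumE.
  transitivity (N%:R^-1 * \sum_(j < N) rat_exp R (j%:R / N%:R * (m - a)%:~R)).
    by rewrite sum_rat_exp// mulrC mulfK// pnatr_eq0 -lt0n.
  rewrite mulr_sumr; apply: eq_bigr => j _.
  by rewrite scale_seqE w_rat_exp intrB mulrBr.
by apply: rpred_sum => j _; apply/VpredZ/Vpred_w.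
Qed.

(** A sequence of period N is the combination of the N residue indicators whose
coefficients are its values at 0, ..., N - 1. *)
Lemma period_Vpred N s : (0 < N)%N -> seq_period N s -> s \in Vpred R.
Proof.
move=> N0 sN; have N0' : N%:Z != 0 by rewrite eqz_nat -lt0n.
have -> : s = \sum_(k < N) s k%:Z *: residue_indicator N k%:Z.
  apply/funext => m; rewrite fct_sumE.
  have rE : `|(m %% N%:Z)%Z|%N = (m %% N%:Z)%Z :> int.
    by rewrite gez0_abs// modz_ge0.
  have rN : (`|(m %% N%:Z)%Z| < N)%N by rewrite -ltz_nat rE ltz_mod.
  (* At m only the class of m contributes, represented by its remainder. *)
  rewrite (bigD1 (Ordinal rN)) //= big1 ?addr0 => [|k kr].
    rewrite scale_seqE /residue_indicator rE seq_period_modz//.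
    by rewrite {3}(divz_eq m N%:Z) addrK dvdz_mull// mulr1.
  rewrite scale_seqE /residue_indicator.
  have [/dvdzP[q qE]|] := boolP (_ %| _)%Z; last by rewrite mulr0.
  case/eqP: kr; apply: val_inj => /=.
  have -> : m = q * N%:Z + k by rewrite -qE subrK.
  by rewrite modzMDl modz_small//= ltz_nat ltn_ord.
by apply: rpred_sum => k _; apply/VpredZ/residue_indicator_Vpred.
Qed.

End FourierInversion.

(** * Units and non-zero-divisors of V *)

Section Units.
Variable R : realType.

(** The pointwise inverse has the same period, hence belongs to V. *)
Lemma nodeless_invertible (P : V R) :
  P \in nodeless R -> exists Q : V R, P * Q = 1.
Proof.
move=> /asboolP P0; have [N N0 PN] := V_period P.
have iV : (fun m => (P m)^-1) \in Vpred R.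
  by apply: period_Vpred N0 _ => m; rewrite PN.
exists (MkV iV); apply: val_inj; apply/funext => m.
exact: divff (P0 m).
Qed.

(** If Phi has period N and a node at m, then it vanishes on all of m + N Z and
so annihilates the indicator of that class. *)
Lemma nonzerodiv_nodeless : nonzerodiv (A := V R) =i nodeless R.
Proof.
move=> P; apply/idP/idP=> [/asboolP Preg|]; last first.
  move=> /nodeless_invertible[Q PQ].
  by apply/asboolP => S PS; rewrite -[S]mul1r -PQ mulrAC PS mul0r.
apply/asboolP => m; apply/negP => /eqP Pm0.
have [N N0 PN] := V_period P.
pose delta := MkV (residue_indicator_Vpred R m N0).
suff /(congr1 (fun S : V R => S m))/eqP : delta = 0.
  by rewrite /= /residue_indicator subrr dvdz0 oner_eq0.
apply: Preg; apply: val_inj; apply/funext => k.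
transitivity (P k * residue_indicator R N m k) => //.
rewrite /residue_indicator.
have [/dvdzP[q qE]|] := boolP (_ %| _)%Z; last by rewrite mulr0.
by rewrite -(subrK m k) qE addrC seq_periodZ// Pm0 mul0r.
Qed.

End Units.

(** * Localization at units, and inverse ring isomorphisms *)

(** When s t = 1, the fraction a / s is the image of a t; and a unit can be
cancelled from the equation u a = u b that expresses equality of fractions. *)
Lemma loc_map_bijective (A : comPzRingType) (S : mulrClosed A) :
  (forall s, s \in S -> exists t, s * t = 1) -> bijective (loc_map S).
Proof.
move=> SU; have SI u a b : u \in S -> u * a = u * b -> a = b.
  move=> /SU[v uv] e; rewrite -[a]mul1r -[b]mul1r -uv.
  by rewrite (mulrC u) -!mulrA e.
have inj : injective (loc_map S).
  by move=> a b /loc_frac_eqP[u uS]; rewrite !mulr1; exact: SI.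
have surj q : exists a, loc_map S a = q.
  elim/loc_fracW: q => a s sS; have [t st] := SU _ sS.
  by exists (a * t); apply: loc_fracI; rewrite mulr1 -mulrA (mulrC t) st mulr1.
have [h hK] := choice surj.
by exists h => // a; apply: inj; rewrite hK.
Qed.

Lemma ring_isomorphic_sym (A B : pzRingType) :
  ring_isomorphic A B -> ring_isomorphic B A.
Proof.
case=> f [g fK gK].
pose gz := GRing.isZmodMorphism.Build _ _ g (can2_zmod_morphism fK gK).
pose gm := GRing.isMonoidMorphism.Build _ _ g (can2_monoid_morphism fK gK).
pose h : {rmorphism B -> A} := HB.pack g gz gm.
by exists h; exists f.
Qed.

(** * Evaluation of n-periodic sequences on one period *)

Section PeriodEvaluation.
Variables (R : realType) (n : nat).

Definition Vn_eval (P : Vn R n) : {ffun 'I_n -> R[i]} :=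
  [ffun k : 'I_n => P k%:Z].

Lemma Vn_eval_zmod_morphism : zmod_morphism Vn_eval.
Proof. by move=> P Q; apply/ffunP => k; rewrite !ffunE. Qed.

Lemma Vn_eval_scal c : Vn_eval (scal R n c) = [ffun=> c].
Proof. by apply/ffunP => k; rewrite !ffunE [LHS]scalVE. Qed.

Lemma Vn_eval_monoid_morphism : monoid_morphism Vn_eval.
Proof.
split=> [|P Q]; first by rewrite -(rmorph1 (scal R n)) Vn_eval_scal.
by apply/ffunP => k; rewrite !ffunE.
Qed.

HB.instance Definition _ :=
  GRing.isZmodMorphism.Build _ _ Vn_eval Vn_eval_zmod_morphism.
HB.instance Definition _ :=
  GRing.isMonoidMorphism.Build _ _ Vn_eval Vn_eval_monoid_morphism.

(** The inverse extends a family of n values periodically, through the remainder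
modulo n; the extension lies in V by Fourier inversion. *)
Lemma Vn_eval_bijective : (0 < n)%N -> bijective Vn_eval.
Proof.
move=> n0; have nz : n%:Z != 0 by rewrite eqz_nat -lt0n.
have rn m : (`|(m %% n%:Z)%Z| < n)%N.
  by rewrite -ltz_nat gez0_abs ?modz_ge0// ltz_mod.
pose r m := Ordinal (rn m).
have rE m : (r m)%:Z = (m %% n%:Z)%Z by rewrite /= gez0_abs ?modz_ge0.
have rD m : r (m + n%:Z) = r m.
  by apply: val_inj => /=; rewrite modzDr.
have extV (f : {ffun 'I_n -> R[i]}) : (f \o r) \in Vpred R.
  by apply: period_Vpred n0 _ => m /=; rewrite rD.
have extVn f : MkV (extV f) \in Defs.periodic R n.
  by apply/asboolP => m /=; rewrite rD.
exists (fun f => MkVn (extVn f)) => [P|f].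
  do 2!apply: val_inj; apply/funext => m /=.
  by rewrite ffunE rE seq_period_modz//; apply/asboolP/(VnP P).
apply/ffunP => k; rewrite ffunE /=; congr (f _).
by apply: val_inj; rewrite /= modz_small//= ltz_nat.
Qed.

End PeriodEvaluation.

Theorem theorem10p9 (R : realType) :
  [/\ nonzerodiv (A := V R) =i nodeless R,
      forall q : QV R, exists (Psi Phi : V R) (PhiU : Phi \in nodeless R),
        q = loc_frac Psi PhiU,
      bijective (loc_map (nodeless R) : {rmorphism V R -> QV R}),
      ring_isomorphic (QV R) (V R)
    & forall n : nat, (0 < n)%N ->
        injective (scal R n : {rmorphism R[i] -> Vn R n}) /\
        exists e : {rmorphism Vn R n -> {ffun 'I_n -> R[i]}},
          bijective e /\ forall c : R[i], e (scal R n c) = [ffun=> c]].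
Proof.
have locbij : bijective (loc_map (nodeless R)).
  exact: loc_map_bijective (@nodeless_invertible R).
split=> [| | | |n n0].
- exact: nonzerodiv_nodeless.
- by elim/loc_fracW=> Psi Phi PhiU; exists Psi, Phi, PhiU.
- exact: locbij.
- by apply: ring_isomorphic_sym; exists (loc_map (nodeless R)).
split=> [a b ab|].
  have /ffunP/(_ (Ordinal n0)) := congr1 (@Vn_eval R n) ab.
  by rewrite !Vn_eval_scal !ffunE.
exists (@Vn_eval R n : {rmorphism _ -> _}).
by split; [exact: Vn_eval_bijective | exact: Vn_eval_scal].
Qed.
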